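(* Let $\Bbbk$ be a field and let $A$ be a finite-dimensional semisimple $\Bbbk$-algebra with Frobenius trace form $\lambda$. Let $c_\lambda \in A \otimes_\Bbbk A$ be the Casimir element and $\gamma_\lambda$ the Casimir trace of $(A,\lambda)$. Let $S$ be any irreducible representation of $A$, with central primitive idempotent $e(S)$, character $\chi_S$, and $d(S) = \dim_{D(S)} S$, where $D(S) = \operatorname{End}_A(S)$. Then, in $A = \Bbbk \otimes_\Bbbk A = A \otimes_\Bbbk \Bbbk$, $$\gamma_\lambda(1)\, e(S) = d(S)\,(\chi_S \otimes \operatorname{Id}_A)(c_\lambda) = d(S)\,(\operatorname{Id}_A \otimes \chi_S)(c_\lambda).$$ In particular, $\gamma_\lambda(1)_S = 0$ if and only if $\chi_S = 0$ or $d(S)\,1_\Bbbk = 0$.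
   Context: Algebras are associative and unital over the field $\Bbbk$; $\mathscr{Z}A$ is the center of $A$; $\langle\cdot,\cdot\rangle$ is the evaluation pairing $A^*\times A\to\Bbbk$, where $A^*=\operatorname{Hom}_\Bbbk(A,\Bbbk)$. A Frobenius (trace) form for a finite-dimensional algebra $A$ is a linear form $\lambda \in A^*$ with $\langle\lambda,ab\rangle=\langle\lambda,ba\rangle$ for all $a,b\in A$ that does not vanish on any nonzero ideal of $A$. The Casimir element of $(A,\lambda)$ is the unique element $c_\lambda=\sum_i x_i\otimes y_i \in A\otimes_\Bbbk A$ such that $a=\sum_i x_i\langle\lambda,ay_i\rangle$ for all $a\in A$; equivalently, one may take $\{x_i\}$ to be a $\Bbbk$-basis of $A$ and $\{y_i\}$ the basis with $\langle\lambda,x_iy_j\rangle=\delta_{i,j}$. The Casimir trace is the map $\gamma_\lambda\colon A\to \mathscr{Z}A$, $\gamma_\lambda(a)=\sum_i x_iay_i$. For an irreducible representation $S$ of $A$: $D(S)=\operatorname{End}_A(S)$ is its Schur division algebra, $a_S\in\operatorname{End}_{D(S)}(S)$ is the operator by which $a\in A$ acts on $S$, and the character is $\langle\chi_S,a\rangle=\operatorname{trace}(a_S)$, the trace of $a_S$ as a $\Bbbk$-linear operator on $S$. For $A$ finite-dimensional semisimple, the central primitive idempotent $e(S)\in\mathscr{Z}A$ is the unique element that acts as the identity on $S$ and as $0$ on every irreducible representation of $A$ not isomorphic to $S$. *)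

(* Defs.v *)
From HB Require Import structures.
From mathcomp Require Import all_boot all_order all_algebra all_field.
From mathcomp Require classical_sets.

Set Implicit Arguments.
Unset Strict Implicit.
Unset Printing Implicit Defensive.

Import GRing.Theory.
Local Open Scope ring_scope.

(* U (x) V for finite-dimensional U and V: t i j is the coefficient of t on
   e_i (x) f_j, where e and f are the bases chosen by vbasis.  The choice is
   immaterial by the universal property: tens_bilinear, tens_lift_linear,
   tens_lift_tens and tens_lift_uniq. *)
Notation tensor U V := 'M[_]_(\dim {:U%type}, \dim {:V%type}).

Section Tensor.
Variable K : fieldType.

Definition tens (U V : vectType K) (u : U) (v : V) :
    'M[K]_(\dim {:U}, \dim {:V}) :=
  \matrix_(i, j) (coord (vbasis {:U}) i u * coord (vbasis {:V}) j v).

(* The linear map U (x) V -> W with u (x) v |-> b u v, for b bilinear. *)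
Definition tens_lift (U V W : vectType K) (b : U -> V -> W)
    (t : tensor U V) : W :=
  \sum_i \sum_j t i j *: b (vbasis {:U})`_i (vbasis {:V})`_j.

Section Universal.
Variables U V W : vectType K.

Lemma tens_bilinear :
  (forall u, linear (@tens U V u)) /\ (forall v, linear ((@tens U V)^~ v)).
Proof.
split=> [u k v w | v k u w]; apply/matrixP=> i j; rewrite !mxE linearP /=.
  by rewrite mulrDr mulrCA.
by rewrite mulrDl mulrA.
Qed.

Lemma tens_lift_linear (b : U -> V -> W) : linear (tens_lift b).
Proof.
move=> k s t; rewrite /tens_lift scaler_sumr -big_split /=.
apply: eq_bigr => i _; rewrite scaler_sumr -big_split /=.
by apply: eq_bigr => j _; rewrite !mxE scalerDl scalerA.
Qed.

Lemma tens_lift_tens (b : U -> V -> W) :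
    (forall u, linear (b u)) -> (forall v, linear (b^~ v)) ->
  forall u v, tens_lift b (tens u v) = b u v.
Proof.
move=> bl br u v.
pose blM u' := GRing.isLinear.Build K V W _ (b u') (bl u').
pose blL u' : {linear V -> W} := HB.pack (b u') (blM u').
pose brM v' := GRing.isLinear.Build K U W _ (b^~ v') (br v').
pose brL v' : {linear U -> W} := HB.pack (b^~ v') (brM v').
have Er v' : b u v' =
    \sum_i coord (vbasis {:U}) i u *: b (vbasis {:U})`_i v'.
  rewrite {1}(coord_vbasis (memvf u)) -[LHS]/(brL v' _).
  rewrite (linear_sum (brL v')).
  by apply: eq_bigr => i _; rewrite (linearZ_LR (brL v')).
rewrite Er; apply: eq_bigr => i _.
rewrite {2}(coord_vbasis (memvf v)) -[b _ _]/(blL _ _).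
rewrite (linear_sum (blL _)) scaler_sumr.
by apply: eq_bigr => j _; rewrite mxE (linearZ_LR (blL _)) scalerA.
Qed.

Lemma tens_lift_uniq (g h : {linear tensor U V -> W}) :
  (forall u v, g (tens u v) = h (tens u v)) -> g =1 h.
Proof.
move=> gh t.
have -> : t = \sum_i \sum_j
    t i j *: tens (vbasis {:U})`_i (vbasis {:V})`_j :> tensor U V.
  rewrite [LHS]matrix_sum_delta; apply: eq_bigr => i _; apply: eq_bigr => j _.
  congr (_ *: _); apply/matrixP=> k l; rewrite !mxE.
  rewrite !coord_free ?(basis_free (vbasisP _)) //.
  by rewrite -natrM mulnb !(eq_sym k) !(eq_sym l).
rewrite !linear_sum; apply: eq_bigr => i _.
rewrite !linear_sum; apply: eq_bigr => j _.
by rewrite !linearZ gh.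
Qed.

End Universal.
End Tensor.

Section Representations.
Variables (K : fieldType) (A : falgType K).

(* The ring structure the library puts on 'End(V) is the opposite of
   composition, so multiplicativity is stated with \o. *)
Record representation (V : vectType K) := Representation {
  repr_fun :> {linear A -> 'End(V)};
  repr1 : repr_fun 1 = \1%VF;
  reprM : forall a b, repr_fun (a * b) = (repr_fun a \o repr_fun b)%VF
}.

Lemma amullM_comp (a b : A) : amull (a * b) = (amull a \o amull b)%VF.
Proof. by apply/lfunP=> c; rewrite comp_lfunE !lfunE /= mulrA. Qed.

Definition regular_repr : representation A :=
  @Representation A (@amull K A : {linear A -> 'End(A)}) (@amull1 K A)
    amullM_comp.

Definition subrepr V (rho : representation V) (U : {vspace V}) : Prop :=
  forall a, (rho a @: U <= U)%VS.

Definition irreducible_repr V (rho : representation V) : Prop :=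
  {:V}%VS <> 0%VS /\
  forall U : {vspace V}, subrepr rho U -> U = 0%VS \/ U = {:V}%VS.

Definition completely_reducible V (rho : representation V) : Prop :=
  forall U : {vspace V}, subrepr rho U ->
  exists W : {vspace V},
    [/\ subrepr rho W, (U + W = {:V})%VS & (U :&: W = 0)%VS].

Definition intertwiner V W (rho : representation V) (sigma : representation W)
    (f : 'Hom(V, W)) : Prop :=
  forall a, (f \o rho a)%VF = (sigma a \o f)%VF.

Definition isomorphic_repr V W (rho : representation V)
    (sigma : representation W) : Prop :=
  exists f : 'Hom(V, W),
    [/\ intertwiner rho sigma f, lker f = 0%VS & limg f = {:W}%VS].

Definition character V (rho : representation V) (a : A) : K :=
  \tr (passmx.mxof (vbasis {:V}) (vbasis {:V}) (rho a)).

Lemma character_linear V (rho : representation V) :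
  linear (character rho : A -> K^o).
Proof.
by move=> k a b; rewrite /character linearP passmx.mxof_linear linearP.
Qed.

HB.instance Definition _ V (rho : representation V) :=
  GRing.isLinear.Build K A K^o _ (character rho : A -> K^o)
    (character_linear rho).

(* D(S), whose elements act on S by evaluation. *)
Definition schur_end V (rho : representation V) (f : 'End(V)) : Prop :=
  intertwiner rho rho f.

Definition schur_basis V (rho : representation V) n (v : 'I_n -> V) : Prop :=
  (forall u, exists2 d : 'I_n -> 'End(V),
     (forall i, schur_end rho (d i)) & u = \sum_i d i (v i)) /\
  (forall d : 'I_n -> 'End(V), (forall i, schur_end rho (d i)) ->
     \sum_i d i (v i) = 0 -> forall i, d i = 0).

(* d(S) = dim_{D(S)} S; the default 0 is never reached for irreducible S. *)
Definition schur_dim V (rho : representation V) : nat :=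
  classical_sets.xget 0%N
    (fun n => exists v : 'I_n -> V, schur_basis rho v).

Definition is_central_idempotent V (rho : representation V) (e : A) : Prop :=
  [/\ e \in 'Z({:A})%VS, rho e = \1%VF &
      forall (W : vectType K) (sigma : representation W),
        irreducible_repr sigma -> ~ isomorphic_repr sigma rho ->
        sigma e = 0].

(* e(S), characterized uniquely when A is semisimple and S irreducible. *)
Definition central_idempotent V (rho : representation V) : A :=
  classical_sets.xget 0 (is_central_idempotent rho).

End Representations.

Section Frobenius.
Variables (K : fieldType) (A : falgType K).

Definition semisimple : Prop := completely_reducible (regular_repr A).

Definition ideal (I : {vspace A}) : Prop :=
  forall a x, x \in I -> (a * x \in I) /\ (x * a \in I).

Definition frobenius_trace_form (lam : {linear A -> K^o}) : Prop :=
  (forall a b, lam (a * b) = lam (b * a)) /\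
  (forall I : {vspace A}, ideal I -> I <> 0%VS ->
     exists2 x, x \in I & lam x <> 0).

Definition is_casimir (lam : {linear A -> K^o}) (c : tensor A A) : Prop :=
  forall a, a = tens_lift (fun x y => (lam (a * y) : K) *: x) c.

(* c_lam, characterized uniquely when lam is a Frobenius form. *)
Definition casimir (lam : {linear A -> K^o}) : tensor A A :=
  classical_sets.xget 0 (is_casimir lam).

Definition casimir_trace (lam : {linear A -> K^o}) (a : A) : A :=
  tens_lift (fun x y => x * a * y) (casimir lam).

(* f (x) Id_A and Id_A (x) f for a linear form f, followed by the
   identifications of K (x) A and A (x) K with A. *)
Definition form_tens_id (f : A -> K) : tensor A A -> A :=
  tens_lift (fun x y => f x *: y).

Definition id_tens_form (f : A -> K) : tensor A A -> A :=
  tens_lift (fun x y => f y *: x).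

End Frobenius.

Arguments representation {K} A V.
Arguments semisimple {K} A.

(* Main.v *)
(* The form lam is nondegenerate, so both sides may be tested against
   lam (_ * x).  Expanding along c_lam, lam (gamma(1) * z) is the trace of left
   multiplication by z on A, while lam ((chi (x) Id)(c_lam) * x) and
   lam ((Id (x) chi)(c_lam) * x) are both chi x.  The identity thus says that
   e(S) x has trace d(S) chi_S(x) on A.  This holds because evaluating on a
   D(S)-basis v of S gives an isomorphism of left modules A e(S) -> S^d(S),
   a |-> (a v_i): it is onto by density, and injective because an element
   killing every irreducible representation of a semisimple algebra is zero. *)
From HB Require Import structures.
Require Import Defs.
From mathcomp Require Import all_boot all_order all_algebra all_field.
From mathcomp Require boolp classical_sets.

Set Implicit Arguments.
Unset Strict Implicit.
Unset Printing Implicit Defensive.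

Import GRing.Theory passmx.
Local Open Scope ring_scope.

Lemma linear_formZ (K : fieldType) (V : lmodType K) (f : {linear V -> K^o})
  (k : K) (v : V) : f (k *: v) = k * f v.
Proof. exact: linearZ. Qed.

(** * Frobenius forms and Casimir expansions *)

Section FrobeniusForm.
Variables (K : fieldType) (A : falgType K) (lam : {linear A -> K^o}).
Hypothesis hlam : frobenius_trace_form lam.

Local Notation E := (vbasis {:A}).

Lemma frobenius_nondegenerate (a : A) :
  (forall b, lam (a * b) = 0 :> K) -> a = 0.
Proof.
move=> a0; case: hlam => lamC lamI.
(* The radical of the form, cut out by basis vectors so that it is a subspace by construction.
   Symmetry of [lam] makes it two-sided, and [lam] vanishes on it (take b = 1). *)
pose I := (\bigcap_(i < \dim {:A}) lker (linfun lam \o amulr E`_i))%VS.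
have inI x : reflect (forall b, lam (x * b) = 0 :> K) (x \in I).
  apply: (iffP idP) => [xI b|x0]; last first.
    rewrite memvE; apply/subv_bigcapP => i _.
    by rewrite -memvE memv_ker comp_lfunE !lfunE /= x0.
  rewrite (coord_vbasis (memvf b)) mulr_sumr linear_sum big1 // => i _.
  rewrite -scalerAr linearZ /=.
  move: xI; rewrite memvE => /subv_bigcapP/(_ i isT).
  by rewrite -memvE memv_ker comp_lfunE !lfunE /= => /eqP ->; rewrite scaler0.
have idI : ideal I.
  move=> b x /inI x0; split; apply/inI => c; last by rewrite -mulrA x0.
  by rewrite -mulrA lamC -mulrA x0.
have [I0|/eqP I0] := eqVneq I 0%VS.
  by apply/eqP; rewrite -memv0 -I0; apply/inI.
by have [x /inI/(_ 1)] := lamI I idI I0; rewrite mulr1.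
Qed.

Lemma frobenius_form_inj (a b : A) :
  (forall x, lam (a * x) = lam (b * x) :> K) -> a = b.
Proof.
move=> ab; apply/eqP; rewrite -subr_eq0; apply/eqP/frobenius_nondegenerate => x.
by rewrite mulrBl linearB /= ab subrr.
Qed.

(** Only existence is at stake: nondegeneracy makes the Gram matrix [M] of [lam] invertible, and its
    inverse supplies the coefficients. *)
Lemma casimirP : is_casimir lam (casimir lam).
Proof.
apply: classical_sets.xgetPex.
pose M : 'M[K]_(\dim {:A}) := \matrix_(i, j) (lam (E`_i * E`_j) : K).
have uM (u : 'rV[K]_(\dim {:A})) j :
    (u *m M) 0 j = lam ((\sum_i u 0 i *: E`_i) * E`_j).
  rewrite mxE mulr_suml linear_sum; apply: eq_bigr => i _.
  by rewrite mxE -scalerAl linearZ.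
have Mu : M \in unitmx.
  rewrite -row_free_unit -kermx_eq0; apply/eqP/row_matrixP => i.
  rewrite row0; set u := row i _.
  have u0 : u *m M = 0 by rewrite -row_mul mulmx_ker row0.
  pose a := \sum_i u 0 i *: E`_i.
  have a0 : a = 0.
    apply: frobenius_nondegenerate => b.
    rewrite (coord_vbasis (memvf b)) mulr_sumr linear_sum big1 // => j _.
    by rewrite -scalerAr linearZ /= -uM u0 mxE scaler0.
  apply/rowP => k; rewrite [RHS]mxE.
  rewrite -(coord_sum_free (u 0) k (basis_free (vbasisP {:A}))).
  by rewrite -/a a0 linear0.
(* If u is the coordinate row of a, then u M lists the values lam (a E_j). Multiplying by the
   inverse of M recovers u, so c_ij is the (j, i) entry of that inverse. *)
exists (invmx M)^T => a; rewrite /tens_lift.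
pose u := \row_i coord E i a.
have au : a = \sum_i u 0 i *: E`_i.
  by rewrite {1}(coord_vbasis (memvf a)); apply: eq_bigr => i _; rewrite mxE.
rewrite {1}au; apply: eq_bigr => i _.
under eq_bigr do rewrite scalerA.
rewrite -scaler_suml; congr (_ *: _).
rewrite -[u in LHS](mulmxK Mu) mxE; apply: eq_bigr => j _.
by rewrite uM -au [in RHS]mxE mulrC.
Qed.

Lemma casimir_expand (a : A) :
  a = \sum_i \sum_j (casimir lam i j * lam (a * E`_j)) *: E`_i.
Proof.
rewrite {1}(casimirP a); apply: eq_bigr => i _; apply: eq_bigr => j _.
by rewrite scalerA.
Qed.

(** Pairing with x and expanding x instead of a gives the same double sum on both sides, by symmetry
    of [lam]. *)
Lemma casimir_expand_dual (a : A) :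
  a = \sum_i \sum_j (casimir lam i j * lam (E`_i * a)) *: E`_j.
Proof.
have lamC := hlam.1.
apply: frobenius_form_inj => x; rewrite lamC [in LHS](casimir_expand x).
rewrite !mulr_suml !linear_sum; apply: eq_bigr => i _.
rewrite !mulr_suml !linear_sum; apply: eq_bigr => j _.
by rewrite -!scalerAl !linear_formZ mulrAC (lamC x).
Qed.

Lemma form_tens_id_casimir (f : {linear A -> K^o}) (x : A) :
  lam (form_tens_id f (casimir lam) * x) = f x.
Proof.
rewrite [in RHS](casimir_expand x) mulr_suml !linear_sum.
apply: eq_bigr => i _; rewrite mulr_suml !linear_sum; apply: eq_bigr => j _.
rewrite -!scalerAl !linear_formZ (hlam.1 x) -[RHS]mulrA.
by rewrite [X in _ = _ * X]mulrC.
Qed.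

Lemma id_tens_form_casimir (f : {linear A -> K^o}) (x : A) :
  lam (id_tens_form f (casimir lam) * x) = f x.
Proof.
rewrite [in RHS](casimir_expand_dual x) mulr_suml !linear_sum.
apply: eq_bigr => i _; rewrite mulr_suml !linear_sum; apply: eq_bigr => j _.
by rewrite -!scalerAl !linear_formZ -[RHS]mulrA [X in _ = _ * X]mulrC.
Qed.

(** The k-th diagonal entry of left multiplication by z is the E_k-coordinate of z E_k, which the
    Casimir expansion gives as the sum over j of c_kj lam (z E_k E_j). *)
Lemma casimir_trace_regular (z : A) :
  lam (casimir_trace lam 1 * z) = character (regular_repr A) z.
Proof.
rewrite mulr_suml linear_sum; apply: eq_bigr => k _.
rewrite !mxE /= vecof_delta lfunE /=.
rewrite [in RHS](casimir_expand (z * _)) linear_sum [RHS](bigD1 k) //=.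
rewrite [X in _ + X]big1 ?addr0.
  rewrite mulr_suml !linear_sum; apply: eq_bigr => j _.
  rewrite -scalerAl linear_formZ mulr1 (hlam.1 _ z) mulrA linearZ /=.
  by rewrite coord_free ?(basis_free (vbasisP _)) // eqxx mulr1.
move=> i /negPf ik; rewrite linear_sum big1 // => j _.
by rewrite linearZ /= coord_free ?(basis_free (vbasisP _)) // ik mulr0.
Qed.

End FrobeniusForm.

Lemma lfun_of_linear (K : fieldType) (V W : vectType K) (g : V -> W) :
  linear g -> {f : 'Hom(V, W) | f =1 g}.
Proof.
move=> gl; pose gM := GRing.isLinear.Build K V W _ g gl.
pose gL : {linear V -> W} := HB.pack g gM.
by exists (linfun gL) => v; rewrite lfunE.
Qed.

(** * Density and bases over the Schur division algebra *)

Section Representation.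
Variables (K : fieldType) (A : falgType K).
Variables (V : vectType K) (rho : representation A V).

Lemma repr1E v : rho 1 v = v.
Proof. by rewrite repr1 id_lfunE. Qed.

Lemma reprME a b v : rho (a * b) v = rho a (rho b v).
Proof. by rewrite reprM comp_lfunE. Qed.

Lemma orbit_linear v : linear (fun a => rho a v).
Proof. by move=> k a b; rewrite linearP add_lfunE scale_lfunE. Qed.

Definition orbit_map v : 'Hom(A, V) := sval (lfun_of_linear (orbit_linear v)).

Lemma orbit_mapE v a : orbit_map v a = rho a v.
Proof. exact: (svalP (lfun_of_linear (orbit_linear v))). Qed.

(** The conclusion of the density theorem: evaluation at the v_i maps A onto V^n. *)
Definition separated n (v : 'I_n -> V) : Prop :=
  forall s : 'I_n -> V, exists a, forall i, rho a (v i) = s i.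

(** A map killing the kernel of the surjection A -> V^n factors through V^n; the psi_i are the
    components of the induced map. The second clause computes psi_i s from any lift of s placed in
    slot i. *)
Lemma separated_factor n (v : 'I_n -> V) (W : vectType K) (f : 'Hom(A, W)) :
    separated v -> (forall a, (forall i, rho a (v i) = 0) -> f a = 0) ->
  exists psi : 'I_n -> 'Hom(V, W),
    (forall a, f a = \sum_i psi i (rho a (v i))) /\
    (forall i s a, (forall j, rho a (v j) = s *+ (j == i)) -> psi i s = f a).
Proof.
move=> sv f0.
have feq a b : (forall i, rho a (v i) = rho b (v i)) -> f a = f b.
  move=> ab; apply/eqP; rewrite -subr_eq0 -linearB; apply/eqP/f0 => i.
  by rewrite -!orbit_mapE linearB /= !orbit_mapE ab subrr.
(* The chosen lifts need not depend linearly on s, but by [feq] their images under f do. *)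
have [al alP] := boolp.choice
  (fun p : 'I_n * V => sv (fun j => p.2 *+ (j == p.1))).
have psil i : linear (fun s => f (al (i, s))).
  move=> k s t; rewrite -linearP /=; apply: feq => j.
  by rewrite alP -orbit_mapE linearP /= !orbit_mapE !alP mulrnDl scalerMnr.
have psiE i s a : (forall j, rho a (v j) = s *+ (j == i)) ->
    sval (lfun_of_linear (psil i)) s = f a.
  move=> aP; rewrite (svalP (lfun_of_linear (psil i))); apply: feq => j.
  by rewrite alP aP.
exists (fun i => sval (lfun_of_linear (psil i))); split=> // a.
rewrite (eq_bigr (fun i => f (al (i, rho a (v i))))); last first.
  by move=> i _; apply: psiE => j; rewrite alP.
rewrite -linear_sum; apply: feq => j.
rewrite -(orbit_mapE _ (\sum_i _)) linear_sum (bigD1 j) //= orbit_mapE alP eqxx.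
by rewrite big1 ?addr0 // => i /negPf ij; rewrite orbit_mapE alP eq_sym ij.
Qed.

(** If a lifts s in slot i, then x a lifts [rho x s] in the same slot. *)
Lemma factor_intertwiner n (v : 'I_n -> V) (W : vectType K)
    (sigma : representation A W) (f : 'Hom(A, W)) (psi : 'I_n -> 'Hom(V, W)) :
    separated v -> (forall x a, f (x * a) = sigma x (f a)) ->
    (forall i s a, (forall j, rho a (v j) = s *+ (j == i)) -> psi i s = f a) ->
  forall i, intertwiner rho sigma (psi i).
Proof.
move=> sv fM psiE i x; apply/lfunP => s; rewrite !comp_lfunE.
have [a aP] := sv (fun j => s *+ (j == i)).
rewrite (psiE _ _ _ aP) -fM; apply: psiE => j.
by rewrite reprME aP linearMn.
Qed.

(** Inductive step of the density theorem. Let N annihilate the later vectors; N v_0 is a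
    subrepresentation. If it is 0, then a v_0 factors through the other a v_i, and a = 1 writes v_0
    as a D(S)-combination of them. If it is V, adding an element of N to a lift for the others
    corrects the value at v_0. *)
Lemma separated_extend n (v : 'I_n.+1 -> V) :
    irreducible_repr rho -> separated (fun i => v (lift ord0 i)) ->
    ~ (exists2 d : 'I_n -> 'End(V), forall i, schur_end rho (d i) &
       v ord0 = \sum_i d i (v (lift ord0 i))) ->
  separated v.
Proof.
move=> [_ irr] sv nspan s.
pose N := (\bigcap_(i < n) lker (orbit_map (v (lift ord0 i))))%VS.
have NP a : reflect (forall i, rho a (v (lift ord0 i)) = 0) (a \in N).
  apply: (iffP idP) => [aN i|a0].
    move: aN; rewrite memvE => /subv_bigcapP/(_ i isT).
    by rewrite -memvE memv_ker orbit_mapE => /eqP.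
  rewrite memvE; apply/subv_bigcapP => i _.
  by rewrite -memvE memv_ker orbit_mapE a0.
have subU : subrepr rho (orbit_map (v ord0) @: N)%VS.
  move=> x; apply/subvP => _ /memv_imgP[_ /memv_imgP[a /NP aN ->] ->].
  rewrite orbit_mapE -reprME -orbit_mapE; apply/memv_img/NP => i.
  by rewrite reprME aN linear0.
have [U0|UV] := irr _ subU.
  case: nspan.
  have f0 a : (forall i, rho a (v (lift ord0 i)) = 0) ->
      orbit_map (v ord0) a = 0.
    by move=> /NP aN; apply/eqP; rewrite -memv0 -U0 memv_img.
  have [d [dE dP]] := separated_factor sv f0.
  exists d.
    apply: (factor_intertwiner sv _ dP) => x a.
    by rewrite !orbit_mapE reprME.
  rewrite -[LHS]repr1E -orbit_mapE dE; apply: eq_bigr => i _.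
  by rewrite repr1E.
have [a aP] := sv (fun i => s (lift ord0 i)).
have /memv_imgP[b /NP bN sb] : s ord0 - rho a (v ord0) \in
  (orbit_map (v ord0) @: N)%VS by rewrite UV memvf.
exists (a + b) => i; rewrite linearD add_lfunE.
have [j ->|->] := unliftP ord0 i; first by rewrite aP bN addr0.
by rewrite -(orbit_mapE _ b) -sb addrC subrK.
Qed.

Lemma schur_basis_separated n (v : 'I_n -> V) :
  irreducible_repr rho -> schur_basis rho v -> separated v.
Proof.
move=> irr [_]; elim: n v => [|n IHn] v vfree.
  by move=> s; exists 0; case.
apply: separated_extend => //.
  apply: IHn => d dS d0 i.
  pose d' j := if unlift ord0 j is Some i then d i else 0.
  have := vfree d' _ _ (lift ord0 i); rewrite /d' liftK; apply.
    move=> j; case: unliftP => [k _|_] //= a.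
    by rewrite comp_lfun0l comp_lfun0r.
  rewrite big_ord_recl unlift_none zero_lfunE add0r -[RHS]d0.
  by apply: eq_bigr => k _; rewrite liftK.
case=> d dS v0.
(* Coefficients of the relation obtained by moving v_0 to the other side; independence would force
   -1 = 0 on a nonzero space. *)
pose d' j := if unlift ord0 j is Some i then d i else - \1%VF.
have := vfree d' _ _ ord0; rewrite /d' unlift_none => d'0.
have /eqP : - \1%VF = 0 :> 'End(V).
  apply: d'0.
    move=> j; case: unliftP => [k _|_] //= a; apply/lfunP => u.
    by rewrite !comp_lfunE !opp_lfunE !id_lfunE linearN.
  rewrite big_ord_recl unlift_none opp_lfunE id_lfunE v0.
  rewrite [X in - _ + X](eq_bigr (fun i => d i (v (lift ord0 i)))) ?addNr //.
  by move=> k _; rewrite liftK.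
rewrite oppr_eq0 => /eqP id0; case: irr => V0 _; case: V0; apply/eqP.
rewrite -subv0; apply/subvP => u _.
by rewrite -[u]id_lfunE id0 zero_lfunE mem0v.
Qed.

Lemma schur_basis_faithful n (v : 'I_n -> V) a :
  schur_basis rho v -> (forall i, rho a (v i) = 0) -> rho a = 0.
Proof.
move=> [vspan _] a0; apply/lfunP => u; have [d dS ->] := vspan u.
rewrite zero_lfunE linear_sum big1 //= => i _.
by rewrite -comp_lfunE -dS comp_lfunE a0 linear0.
Qed.

(** Lifts of one nonzero vector w, one for each slot, are linearly independent in A. The bound lets
    a separated family of maximal size be chosen. *)
Lemma separated_dim n (v : 'I_n -> V) :
  irreducible_repr rho -> separated v -> (n <= \dim {:A})%N.
Proof.
move=> [/eqP V0 _] sv; pose w := vpick {:V}.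
have w0 : w != 0 by rewrite vpick0.
have [al alP] := boolp.choice (fun i : 'I_n => sv (fun j => w *+ (j == i))).
have alE (i : 'I_n) : [seq al i | i <- enum 'I_n]`_i = al i.
  by rewrite (nth_map i) ?size_enum_ord // nth_ord_enum.
have freeX : free [tuple al i | i < n].
  apply/freeP => k /(congr1 (fun a => rho a)) k0 j.
  apply/eqP; move/lfunP/(_ (v j)): k0; rewrite -!orbit_mapE linear0 linear_sum.
  rewrite (bigD1 j) //= big1 => [|i /negPf ij].
    rewrite addr0 linearZ /= alE orbit_mapE alP eqxx.
    by move/eqP; rewrite scaler_eq0 (negPf w0) orbF.
  by rewrite linearZ /= alE orbit_mapE alP eq_sym ij scaler0.
by move: freeX; rewrite /free size_tuple => /eqP <-; apply/dimvS/subvf.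
Qed.

(** A separated family of maximal size works: a vector outside its D(S)-span would extend it, and a
    lift of s in slot i turns a relation into d_i s = 0. *)
Lemma schur_basis_exists :
  irreducible_repr rho -> exists n (v : 'I_n -> V), schur_basis rho v.
Proof.
move=> irr.
pose P n := boolp.asbool (exists v : 'I_n -> V, separated v).
have P0 : exists n, P n.
  exists 0%N; apply/boolp.asboolP; exists (fun=> 0) => s.
  by exists 0; case.
have Pmax n : P n -> (n <= \dim {:A})%N.
  by move/boolp.asboolP => [v /(separated_dim irr)].
case: (ex_maxnP P0 Pmax) => n /boolp.asboolP[v sv] nmax.
exists n, v; split=> [u|d dS d0 i].
  apply: boolp.contrapT => nspan.
  pose v' j := if unlift ord0 j is Some i then v i else u.
  suff /boolp.asboolP/nmax : exists v' : 'I_n.+1 -> V, separated v'.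
    by rewrite ltnn.
  exists v'; apply: separated_extend => //.
    move=> s; have [a aP] := sv s.
    by exists a => i; rewrite /v' liftK aP.
  rewrite /v' unlift_none => -[d dS uE]; apply: nspan; exists d => //.
  by rewrite uE; apply: eq_bigr => i _; rewrite liftK.
apply/lfunP => s; rewrite zero_lfunE.
have [a aP] := sv (fun j => s *+ (j == i)).
move/(congr1 (rho a)): d0; rewrite linear0 linear_sum (bigD1 i) //= big1.
  by rewrite addr0 -comp_lfunE -dS comp_lfunE aP eqxx.
move=> j /negPf ji; rewrite -comp_lfunE -dS comp_lfunE aP ji.
exact: linear0.
Qed.

Lemma schur_dimP :
  irreducible_repr rho -> exists v : 'I_(schur_dim rho) -> V, schur_basis rho v.
Proof.
by move=> /schur_basis_exists ex; apply: (classical_sets.xgetPex 0%N ex).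
Qed.

End Representation.

(** Cyclicity across two spaces, used to move a trace on A to a trace on S. *)
Lemma mxof_trace_comp (K : fieldType) (V W : vectType K) (f : 'Hom(V, W))
    (g : 'Hom(W, V)) :
  \tr (mxof (vbasis {:V}) (vbasis {:V}) (g \o f)%VF) =
  \tr (mxof (vbasis {:W}) (vbasis {:W}) (f \o g)%VF).
Proof. by rewrite !(mxof_comp _ _ (vbasisP _)) mxtrace_mulC. Qed.

(** * Schur's lemma, restriction, and faithfulness in the semisimple case *)

Section Schur.
Variables (K : fieldType) (A : falgType K).

Lemma schur_lemma (V W : vectType K) (rho : representation A V)
    (sigma : representation A W) (f : 'Hom(V, W)) :
    irreducible_repr rho -> irreducible_repr sigma -> intertwiner rho sigma f ->
  f != 0 -> isomorphic_repr sigma rho.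
Proof.
move=> [_ irrV] [_ irrW] fM f0.
have fME a u : f (rho a u) = sigma a (f u) by rewrite -!comp_lfunE fM.
have kerf : lker f = 0%VS.
  have [|//|kerf] := irrV (lker f).
    move=> a; apply/subvP => _ /memv_imgP[u /[!memv_ker]/eqP fu ->].
    by rewrite fME fu linear0.
  case/eqP: f0; apply/lfunP => u; rewrite zero_lfunE.
  by apply/eqP; rewrite -memv_ker kerf memvf.
have imf : limg f = {:W}%VS.
  have [|imf|//] := irrW (limg f).
    move=> a; apply/subvP => _ /memv_imgP[_ /memv_imgP[u _ ->] ->].
    by rewrite -fME memv_img ?memvf.
  case/eqP: f0; apply/lfunP => u; rewrite zero_lfunE.
  by apply/eqP; rewrite -memv0 -imf memv_img ?memvf.
have fV w : f (f^-1%VF w) = w by rewrite limg_lfunVK ?imf ?memvf.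
have fK u : f^-1%VF (f u) = u by rewrite lker0_lfunK ?kerf.
(* The inverse is given because [is_central_idempotent] compares [sigma] with [rho] in that
   direction. *)
exists f^-1%VF; split.
- move=> a; apply/lfunP => w; rewrite !comp_lfunE.
  by rewrite -{1}[w]fV -fME fK.
- apply/eqP; rewrite -subv0; apply/subvP => w.
  rewrite memv_ker memv0 => /eqP w0.
  by rewrite -(fV w) w0 linear0.
- apply/eqP; rewrite eqEsubv subvf /=; apply/subvP => u _.
  by rewrite -(fK u) memv_img ?memvf.
Qed.

Section Restriction.
Variables (V : vectType K) (rho : representation A V) (U : {vspace V}).
Hypothesis subU : subrepr rho U.

Definition restr_lfun (a : A) : 'End(subvs_of U) :=
  (linfun (vsproj U) \o rho a \o linfun (@vsval _ _ U))%VF.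

Lemma restr_lfunE a u : vsval (restr_lfun a u) = rho a (vsval u).
Proof.
rewrite !comp_lfunE !lfunE /= vsprojK //.
by apply: subvP (subU a) _ _; rewrite memv_img ?subvsP.
Qed.

Lemma restr_lfun_vsproj a v :
  v \in U -> vsval (restr_lfun a (vsproj U v)) = rho a v.
Proof. by move=> vU; rewrite restr_lfunE vsprojK. Qed.

Lemma restr_lfun_linear : linear restr_lfun.
Proof.
move=> k a b; apply/lfunP => u; apply: subvs_inj.
rewrite restr_lfunE linearP add_lfunE scale_lfunE -!restr_lfunE -linearP.
by rewrite !add_lfunE !scale_lfunE.
Qed.

HB.instance Definition _ :=
  GRing.isLinear.Build K A 'End(subvs_of U) _ restr_lfun restr_lfun_linear.

Lemma restr_lfun1 : restr_lfun 1 = \1%VF.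
Proof.
by apply/lfunP => u; apply: subvs_inj; rewrite restr_lfunE repr1 !id_lfunE.
Qed.

Lemma restr_lfunM a b : restr_lfun (a * b) = (restr_lfun a \o restr_lfun b)%VF.
Proof.
apply/lfunP => u; apply: subvs_inj.
by rewrite comp_lfunE !restr_lfunE reprME.
Qed.

Definition restr_repr : representation A (subvs_of U) :=
  Representation restr_lfun1 restr_lfunM.

Lemma restr_repr_irreducible :
    U <> 0%VS ->
    (forall X, subrepr rho X -> (X <= U)%VS -> X = 0%VS \/ X = U) ->
  irreducible_repr restr_repr.
Proof.
move=> U0 minU; pose i := linfun (@vsval _ _ U).
have iE x : i x = vsval x by rewrite lfunE.
split.
  move=> full0; apply: U0; apply/eqP; rewrite -subv0; apply/subvP => u uU.
  have : vsproj U u \in 0%VS by rewrite -full0 memvf.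
  by rewrite !memv0 => /eqP u0; rewrite -(vsprojK uU) u0.
move=> X subX.
have subiX : subrepr rho (i @: X)%VS.
  move=> a; apply/subvP => _ /memv_imgP[_ /memv_imgP[x xX ->] ->].
  rewrite iE -restr_lfunE -iE memv_img //.
  by apply: subvP (subX a) _ _; rewrite memv_img.
have leiX : (i @: X <= U)%VS.
  by apply/subvP => _ /memv_imgP[x _ ->]; rewrite iE subvsP.
have [X0|XU] := minU _ subiX leiX; [left|right].
  apply/eqP; rewrite -subv0; apply/subvP => x xX.
  have : i x \in 0%VS by rewrite -X0 memv_img.
  by rewrite !memv0 iE => /eqP x0; apply/eqP/subvs_inj.
apply/eqP; rewrite eqEsubv subvf; apply/subvP => x _.
have : i x \in (i @: X)%VS by rewrite XU iE subvsP.
by case/memv_imgP => y yX; rewrite !iE => /subvs_inj ->.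
Qed.

End Restriction.

Lemma minimal_subrepr (V : vectType K) (rho : representation A V)
    (U : {vspace V}) : subrepr rho U -> U <> 0%VS ->
  exists W : {vspace V}, [/\ subrepr rho W, (W <= U)%VS, W <> 0%VS &
    forall X, subrepr rho X -> (X <= W)%VS -> X = 0%VS \/ X = W].
Proof.
have [n] := ubnP (\dim U); elim: n U => // n IHn U ltUn subU U0.
have [[X [subX leXU X0 XU]]|noX] := boolp.lem (exists X, [/\ subrepr rho X,
    (X <= U)%VS, X <> 0%VS & X <> U]).
  have [|W [? leWX ? ?]] := IHn X _ subX X0.
    apply: leq_trans (ltUn : \dim U <= n)%N.
    rewrite ltn_neqAle dimvS // andbT; apply/eqP => dimXU; apply: XU.
    by apply/eqP; rewrite eqEdim leXU dimXU /=.
  by exists W; split=> //; apply: subv_trans leXU.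
exists U; split=> // X subX leXU.
have [->|X0] := eqVneq X 0%VS; first by left.
have [->|XU] := eqVneq X U; first by right.
by case: noX; exists X; split=> //; apply/eqP.
Qed.

(** A nonzero complement W of U would contain a minimal left ideal X. As a kills the irreducible X,
    one gets a A X = 0, so X lies in U and in W. Hence U = A and a = 0. *)
Lemma semisimple_faithful (a : A) :
    semisimple A ->
    (forall (W : vectType K) (sigma : representation A W),
       irreducible_repr sigma -> sigma a = 0) ->
  a = 0.
Proof.
move=> ssA a0.
(* Elements u with a A u = 0; the factor A in the middle makes this a left ideal. *)
pose U := (\bigcap_(i < \dim {:A}) lker (amull (a * (vbasis {:A})`_i)%R))%VS.
have UP u : reflect (forall x, a * x * u = 0) (u \in U).
  apply: (iffP idP) => [uU x|u0].
    rewrite (coord_vbasis (memvf x)) mulr_sumr mulr_suml big1 // => i _.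
    move: uU; rewrite memvE => /subv_bigcapP/(_ i isT).
    rewrite -memvE memv_ker lfunE /= => /eqP u0.
    by rewrite -scalerAr -scalerAl u0 scaler0.
  rewrite memvE; apply/subv_bigcapP => i _.
  by rewrite -memvE memv_ker lfunE /= u0.
have [|W [subW UW UIW]] := ssA U.
  move=> x; apply/subvP => _ /memv_imgP[u /UP u0 ->]; apply/UP => y.
  by rewrite lfunE /= mulrA -(mulrA a) u0.
suff W0 : W = 0%VS.
  have /UP/(_ 1) : 1 \in U by move: UW; rewrite W0 addv0 => ->; rewrite memvf.
  by rewrite !mulr1.
have [//|/eqP W0] := eqVneq W 0%VS.
have [X [subX leXW X0 minX]] := minimal_subrepr subW W0.
have sX := a0 _ _ (restr_repr_irreducible subX X0 minX).
case: X0; apply/eqP; rewrite -subv0 -UIW subv_cap leXW andbT.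
apply/subvP => u uX; apply/UP => x; rewrite -mulrA.
have xuX : x * u \in X.
  by move: (subvP (subX x) _ (memv_img _ uX)); rewrite lfunE.
have -> : a * (x * u) = vsval (restr_repr subX a (vsproj X (x * u))).
  by rewrite [RHS](restr_lfun_vsproj subX a xuX) [RHS]lfunE.
by rewrite sX zero_lfunE.
Qed.

End Schur.

(** * The central idempotent and its block *)

Section Proposition4.
Variables (K : fieldType) (A : falgType K) (lam : {linear A -> K^o}).
Variables (V : vectType K) (rho : representation A V).
Hypotheses (hA : semisimple A) (hlam : frobenius_trace_form lam).
Hypothesis hV : irreducible_repr rho.

(** The kernel N of [rho] is an ideal with identity k, so that 1 - k can serve as e(S). Here k is
    the N-component of 1 along a complementary left ideal W. *)
Lemma repr_kernel_identity : exists2 k : A,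
  rho k = 0 & forall x, rho x = 0 -> k * x = x /\ x * k = x.
Proof.
pose N := lker (linfun rho).
have NP a : reflect (rho a = 0) (a \in N).
  by rewrite memv_ker lfunE; apply: eqP.
have idlN a x : x \in N -> a * x \in N.
  by move=> /NP x0; apply/NP; rewrite reprM x0 comp_lfun0r.
have idrN a x : x \in N -> x * a \in N.
  by move=> /NP x0; apply/NP; rewrite reprM x0 comp_lfun0l.
have [|W [subW UW UIW]] := @hA N.
  move=> a; apply/subvP => _ /memv_imgP[x xN ->].
  by rewrite lfunE idlN.
have /memv_addP[k kN [w wW e1]] : 1 \in (N + W)%VS by rewrite UW memvf.
have kr x : x \in N -> x * k = x.
  move=> xN; suff xw : x * w = 0 by rewrite -[RHS]mulr1 e1 mulrDr xw addr0.
  (* x w lies in N because N is a right ideal, and in W because W is a left ideal. *)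
  apply/eqP; rewrite -memv0 -UIW memv_cap idrN //=.
  by move: (subvP (subW x) _ (memv_img _ wW)); rewrite lfunE.
exists k; first exact/NP.
move=> x /NP xN; split; last exact: kr.
(* y := x - k x lies in N and N y = 0, hence
   lam (y b) = lam (y k b) = lam (k b y) = 0. *)
apply/eqP; rewrite eq_sym -subr_eq0; apply/eqP.
set y := x - k * x.
have yN : y \in N by rewrite rpredB // idlN.
have Ny z : z \in N -> z * y = 0 by move=> zN; rewrite mulrBr mulrA kr // subrr.
apply: (frobenius_nondegenerate hlam) => b.
by rewrite -(kr y yN) -mulrA hlam.1 Ny ?linear0 // idrN.
Qed.

Lemma central_idempotentP :
  is_central_idempotent rho (central_idempotent rho).
Proof.
apply: classical_sets.xgetPex.
have [k k0 kid] := repr_kernel_identity.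
have rhoe : rho (1 - k) = \1%VF by rewrite linearB /= k0 subr0 repr1.
(* Both products lie in the kernel, so both equal k a k. *)
have kC a : k * a = a * k.
  have [|_ <-] := kid (k * a); first by rewrite reprM k0 comp_lfun0l.
  have [|<- _] := kid (a * k); first by rewrite reprM k0 comp_lfun0r.
  by rewrite mulrA.
have eC a : (1 - k) * a = a * (1 - k) by rewrite mulrBl mulrBr mul1r mulr1 kC.
exists (1 - k); split=> [|//|W sigma irrW niso].
  by rewrite memv_cap memvf; apply/centvP => a _; apply: eC.
apply/lfunP => w; rewrite zero_lfunE.
have [v vB] := schur_dimP hV.
have sv := schur_basis_separated hV vB.
(* This map kills the kernel of [rho], so it splits into intertwiners from S to W, which vanish by
   Schur's lemma; its value at 1 is [sigma (1 - k) w]. *)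
pose f := (orbit_map sigma w \o amulr (1 - k))%VF.
have fE a : f a = sigma (a * (1 - k)) w.
  by rewrite comp_lfunE orbit_mapE lfunE.
have f0 a : (forall i, rho a (v i) = 0) -> f a = 0.
  move=> /(schur_basis_faithful vB) rhoa.
  by rewrite fE mulrBr mulr1 (kid _ rhoa).2 subrr linear0 zero_lfunE.
have [psi [psiE psiP]] := separated_factor sv f0.
have fM x a : f (x * a) = sigma x (f a) by rewrite !fE -mulrA reprME.
have psiI := factor_intertwiner sv fM psiP.
rewrite -[1 - k]mul1r -fE psiE big1 // => i _.
have [->|psi0] := eqVneq (psi i) 0; first by rewrite zero_lfunE.
by case: niso; apply: schur_lemma (psiI i) psi0.
Qed.

Local Notation e := (central_idempotent rho).

Lemma central_idempotentC a : e * a = a * e.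
Proof.
have [] := central_idempotentP; rewrite memv_cap => /andP[_ /centvP eC] _ _.
by rewrite eC ?memvf.
Qed.

Lemma repr_central_idempotent : rho e = \1%VF.
Proof. by case: central_idempotentP. Qed.

(** On irreducibles isomorphic to S the factor a acts as 0, on all others e does. *)
Lemma repr_block_faithful a : rho a = 0 -> e * a = 0.
Proof.
move=> a0; apply: semisimple_faithful hA _ => W sigma irrW.
have [[f [fI kerf imf]]|niso] := boolp.lem (isomorphic_repr sigma rho).
  apply/lfunP => w; apply: (lker0P (introT eqP kerf)).
  rewrite -comp_lfunE fI comp_lfunE reprME a0 !zero_lfunE.
  by rewrite !linear0.
case: central_idempotentP => _ _ /(_ _ _ irrW niso) e0.
by rewrite reprM e0 comp_lfun0l.
Qed.

(** The psi_i invert the evaluation map A e(S) -> S^d(S). They split left multiplication by e x into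
    d(S) maps passing through S, each with trace chi_S(x). *)
Lemma regular_character_block (x : A) :
  character (regular_repr A) (e * x) = character rho x *+ schur_dim rho.
Proof.
have [v vB] := schur_dimP hV.
have sv := schur_basis_separated hV vB.
have f0 a : (forall i, rho a (v i) = 0) -> amull e a = 0.
  move=> a0; rewrite lfunE /=; apply: repr_block_faithful.
  exact: schur_basis_faithful vB a0.
have [psi [psiE psiP]] := separated_factor sv f0.
have -> : character (regular_repr A) (e * x) =
  \tr (mxof (vbasis {:A}) (vbasis {:A})
    (\sum_i (psi i \o (rho x \o orbit_map rho (v i)))%VF)).
  congr (\tr (mxof _ _ _)); apply/lfunP => b.
  rewrite [LHS]lfunE /= -mulrA -[e * _](lfunE (e \*o idfun)) psiE sum_lfunE.
  by apply: eq_bigr => i _; rewrite !comp_lfunE orbit_mapE reprME.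
rewrite !linear_sum -[in RHS](card_ord (schur_dim rho)) -sumr_const.
apply: eq_bigr => i _ /=; rewrite mxof_trace_comp /character.
congr (\tr (mxof _ _ _)); apply/lfunP => s.
rewrite !comp_lfunE orbit_mapE; congr (rho x _).
(* Evaluation at v_i after psi_i is the identity: psi_i s = e a with a v_i = s, and e acts as 1 on
   S. *)
have [a aP] := sv (fun j => s *+ (j == i)).
rewrite (psiP _ _ _ aP) lfunE /= reprME repr_central_idempotent id_lfunE.
by rewrite aP eqxx.
Qed.

Lemma casimir_trace_central_idempotent (x : A) :
  lam (casimir_trace lam 1 * e * x) = character rho x *+ schur_dim rho.
Proof. by rewrite -mulrA casimir_trace_regular // regular_character_block. Qed.

End Proposition4.

Theorem proposition4 (K : fieldType) (A : falgType K)
    (lam : {linear A -> K^o}) (S : vectType K) (rho : representation A S)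
    (hA : semisimple A) (hlam : frobenius_trace_form lam)
    (hS : irreducible_repr rho) :
  [/\ casimir_trace lam 1 * central_idempotent rho =
        form_tens_id (character rho) (casimir lam) *+ schur_dim rho,
      form_tens_id (character rho) (casimir lam) *+ schur_dim rho =
        id_tens_form (character rho) (casimir lam) *+ schur_dim rho &
      rho (casimir_trace lam 1) = 0 <->
        (forall a : A, character rho a = 0) \/ (schur_dim rho)%:R = 0 :> K].
Proof.
have traceE := casimir_trace_central_idempotent hA hlam hS.
split.
- apply: (frobenius_form_inj hlam) => x.
  by rewrite traceE mulrnAl linearMn /= form_tens_id_casimir.
- apply: (frobenius_form_inj hlam) => x.
  rewrite !mulrnAl !linearMn /= form_tens_id_casimir //.
  by rewrite id_tens_form_casimir.
have rhoe := repr_central_idempotent hA hlam hS.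
split=> [g0|chid0].
  have [d0|d0] := eqVneq ((schur_dim rho)%:R : K) 0; first by right.
  left=> x; apply/eqP; move: (traceE x).
  (* If gamma(1) acts as 0 on S, then e gamma(1) = 0, so the trace identity reads chi_S(x) d(S) =
     0. *)
  rewrite -(central_idempotentC hA hlam hS) (repr_block_faithful hA hlam hS g0).
  rewrite mul0r linear0 -mulr_natr => /esym/eqP.
  by rewrite mulf_eq0 (negPf d0) orbF.
have ge0 : casimir_trace lam 1 * central_idempotent rho = 0.
  apply: (frobenius_nondegenerate hlam) => x; rewrite traceE -mulr_natr.
  by case: chid0 => ->; rewrite ?mul0r ?mulr0.
(* On S, gamma(1) and gamma(1) e act alike. *)
by rewrite -[rho _]comp_lfun1r -rhoe -reprM ge0 linear0.
Qed.
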